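(* Let $p$ be an odd prime and let $G$ be a finite metabelian $p$-group. If the nilpotency class of $G$ is less than or equal to $2p-1$, then $\exp(\gamma_2(G))$ divides $\exp(G/Z(G))$.
   Context: $\exp(H)$ denotes the exponent of a finite group $H$, i.e. the least positive integer $e$ with $h^e=1$ for all $h\in H$. $\gamma_2(G)=[G,G]$ is the commutator subgroup of $G$, and $Z(G)$ is the center. A group is metabelian if its commutator subgroup is abelian. *)

(* Defs.v *)
From mathcomp Require Import all_boot all_fingroup all_solvable.
Set Implicit Arguments.
Unset Strict Implicit.
Unset Printing Implicit Defensive.

Local Open Scope group_scope.

Definition metabelian (gT : finGroupType) (G : {group gT}) : bool :=
  abelian [~: G, G].

(* Main.v *)
Require Import Defs.
From mathcomp Require Import all_boot ssralg all_fingroup all_solvable.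
Set Implicit Arguments.
Unset Strict Implicit.
Unset Printing Implicit Defensive.

Import GRing.Theory FiniteModule.
Local Open Scope group_scope.

(** Why the theorem holds.  Let n be the exponent of G / Z(G), a power of p; if
n = 1 then G is abelian, so let n > 1 and q = n / p.  Write
A = [G, G] additively, as a module on which the abelian group G / A acts.  For
w in A put w (g - 1) = [w, g]; in module form a left-normed commutator of
weight i + 2 is a commutator c = [a, b] acted on by a product of i operators
g - 1, which commute with one another.  Write I for the ideal that these
operators generate: the bound on the class says A I^(2p-2) = 0.

Since A is generated by commutators, it is enough to show n [a, b] = 0.  The
hypothesis enters in two ways.  As n-th powers of elements of A are central,
n A I = 0.  As b^n is central, [a, b^n] = 1, which expands into
  sum_(i < n) 'C(n, i + 1) c (b - 1)^i = 0.                      (R)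
For i + 1 < 2p every 'C(n, i + 1) except 'C(n, p) is a multiple of n, and all
longer terms vanish by the bound on the class; with 'C(n, p) = q r, where
r is prime to p, only two terms of (R) survive:
  n c + r q c (b - 1)^(p-1) = 0.                           (R')
Replacing b by b y with y in A shows that (R) also holds with d (g - 1) in
place of c, for any d in A; then the first term of (R') is 0 as well, so that
q d (g - 1) (b - 1)^(p-1) = 0 for all d, g, b.

The diagonal values (b - 1)^(p-1) determine all products of p - 1 operators by
polarization, which costs only a factor (p - 1)!, prime to p.  Polarization
needs g |-> g - 1 to be additive in the relevant degree; this is arranged by
descending induction on k, and gives q A I^k = 0 for all k >= p
[com_prime_eq0].

Hence F(z) = q c (z - 1)^(p-1) is the diagonal of a symmetric
multiadditive function.  By (R') for the pairs (a, b x) with x in <[a]>, the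
value r F(b x) = - n c does not depend on x.  A polynomial function of degree
p - 1 that is constant on the line b <[a]> has zero leading coefficient there,
so F(a) = 0.  Finally (R') for the pair (b, a) gives r F(a) = - n c, whence
n c = 0 [comm_mulrn_eq0]. *)

(** * Iterated differences and polarization *)

Fixpoint iter_diff (gT : finGroupType) (V : zmodType) (f : gT -> V)
    (xs : seq gT) (y : gT) : V :=
  if xs is x :: xs' then iter_diff (fun z => f (z * x)%g - f z)%R xs' y
  else f y.

Section IterDiff.
Variables (gT : finGroupType) (V : zmodType).
Implicit Types (f g : gT -> V) (H : {group gT}) (xs : seq gT).
Local Open Scope ring_scope.

(** An iterated difference at y with increments in H only samples f on the
coset y H; constancy along such a coset is all that is known in the
application. *)
Lemma eq_iter_diff H y0 xs f g :
    {subset xs <= H} -> {in (y0 *: H)%g, f =1 g} ->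
  {in (y0 *: H)%g, iter_diff f xs =1 iter_diff g xs}.
Proof.
elim: xs f g => [|x xs IH] f g sxH eqfg //=.
have Hx: x \in H by apply: sxH; rewrite mem_head.
move=> y yH; apply: (IH _ _ _ _ y yH) => [z xz | z zH].
  by apply: sxH; rewrite inE xz orbT.
have zxH: (z * x)%g \in (y0 *: H)%g.
  by move: zH; rewrite !mem_lcoset mulgA => zH; rewrite groupM.
by rewrite (eqfg _ zxH) (eqfg _ zH).
Qed.

Lemma iter_diff_cst0 H y0 xs f k :
    {subset xs <= H} -> {in (y0 *: H)%g, forall z, f z = k} ->
    (0 < size xs)%N ->
  {in (y0 *: H)%g, forall y, iter_diff f xs y = 0}.
Proof.
move=> sxH fk xs_gt0 y yH; rewrite (eq_iter_diff (g := fun=> k) sxH fk yH).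
case: xs xs_gt0 {sxH} => //= x xs _.
elim: xs y k {x f fk yH} => [|x xs IH] y k /=; first by rewrite subrr.
exact: IH.
Qed.

Lemma iter_diffD xs f g y :
  iter_diff (fun z => f z + g z) xs y = iter_diff f xs y + iter_diff g xs y.
Proof.
elim: xs f g y => [|x xs IH] f g y //=; rewrite -IH.
apply: (@eq_iter_diff [set: gT]%G y) => [z|z _|]; rewrite ?inE //.
  by rewrite opprD addrACA.
by rewrite mem_lcoset inE.
Qed.

End IterDiff.

Section Polarization.
Variables (gT : finGroupType) (V : zmodType) (G : {group gT}).
Variables (F : seq gT -> V) (m : nat).
Local Open Scope ring_scope.
Hypothesis F_sym : forall s t, {subset s <= G} -> perm_eq s t -> F s = F t.
Hypothesis F_add : forall g h s, g \in G -> h \in G -> {subset s <= G} ->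
  (size s).+1 = m -> F ((g * h)%g :: s) = F (g :: s) + F (h :: s).

Let perm_mid (x : gT) s t : perm_eq (x :: s ++ t) (s ++ x :: t).
Proof. exact/permEl/(perm_catCA [:: x] s t). Qed.

Let sub_cat s t : {subset s <= G} -> {subset t <= G} -> {subset s ++ t <= G}.
Proof. by move=> sG tG x; rewrite mem_cat => /orP[/sG|/tG]. Qed.

Let sub_cons g s : g \in G -> {subset s <= G} -> {subset g :: s <= G}.
Proof. by move=> Gg sG x; rewrite inE => /predU1P[->|/sG]. Qed.

Let sub_map z s : z \in G -> {subset s <= G} ->
  {subset [seq (z * h)%g | h <- s] <= G}.
Proof. by move=> Gz sG _ /mapP[h /sG Gh ->]; rewrite groupM. Qed.

(** F plays the role of a product of m linear factors.  Each difference turns a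
product of j factors z + h into a sum of j products in which one factor has
become the constant x, up to shifts h; after j differences only j! copies of
the product of the increments remain.  The shifts hs make the induction close,
because replacing z by z x in part of the factors merely changes their
shifts. *)
Lemma iter_diff_multiadditive xs hs s y :
    y \in G -> {subset xs <= G} -> {subset hs <= G} -> {subset s <= G} ->
    size hs = size xs -> (size xs + size s = m)%N ->
  iter_diff (fun z => F ([seq (z * h)%g | h <- hs] ++ s)) xs y
    = F (xs ++ s) *+ (size xs)`!.
Proof.
move=> Gy; elim: xs hs s => [|x xs IH] hs s sxs shs ss; first by case: hs shs.
move=> /= szhs szm.
have Gx: x \in G by apply: sxs; rewrite mem_head.
have{} sxs: {subset xs <= G} by move=> z xz; apply: sxs; rewrite inE xz orbT.
have yG: y \in (y *: G)%g by rewrite lcoset_refl.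
have coG z: z \in (y *: G)%g -> z \in G by rewrite lcoset_id.
(* Telescoping: the factors are moved from z to z x one at a time; hs1 lists
   those in which the two terms differ. *)
suff main hs1 hs2 : {subset hs1 <= G} -> {subset hs2 <= G} ->
    (size hs1 + size hs2 = (size xs).+1)%N ->
  iter_diff (fun z => F ([seq (z * x * h)%g | h <- hs1] ++
                         [seq (z * h)%g | h <- hs2] ++ s)
                    - F ([seq (z * h)%g | h <- hs1 ++ hs2] ++ s)) xs y
    = F (x :: xs ++ s) *+ (size hs1 * (size xs)`!).
  move: (main hs [::]); rewrite cats0 addn0 szhs factS => <- //.
elim: hs1 hs2 => [|h hs1 IH1] hs2 shs1 shs2 szh.
  rewrite (@eq_iter_diff _ _ G y _ _ (fun=> 0)) => // [|z _]; last first.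
    by rewrite /= subrr.
  rewrite mul0n mulr0n; elim: (xs) (y) => //= x' xs' IHx y'.
  rewrite -[RHS](IHx y').
  apply: (@eq_iter_diff _ _ [set: gT]%G y') => [z|z _|]; rewrite ?inE //.
    by rewrite subrr.
  by rewrite mem_lcoset inE.
have Gh: h \in G by apply: shs1; rewrite mem_head.
have{} shs1: {subset hs1 <= G}.
  by move=> z xz; apply: shs1; rewrite inE xz orbT.
have shs2h: {subset h :: hs2 <= G} by apply: sub_cons.
have szh': (size hs1 + size (h :: hs2) = (size xs).+1)%N.
  by rewrite -szh /= addSnnS.
have szhs1: size ([seq (x * k)%g | k <- hs1] ++ hs2) = size xs.
  by apply/eqP; rewrite size_cat size_map -eqSS -szh.
rewrite [size (h :: hs1)]/= mulSn addnC mulrnDr -(IH1 (h :: hs2)) //.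
have Fx : F (x :: xs ++ s) = F (xs ++ x :: s).
  apply: F_sym; last exact: perm_mid.
  by apply: sub_cons => //; apply: sub_cat.
rewrite {}Fx -(IH ([seq (x * k)%g | k <- hs1] ++ hs2) (x :: s)) //; first last.
- by rewrite /= addnS.
- exact: sub_cons.
- by apply: sub_cat => //; apply: sub_map.
rewrite -iter_diffD; apply: (eq_iter_diff sxs) yG => z /coG Gz.
have Gzx: (z * x)%g \in G by rewrite groupM.
set M := [seq (z * x * k)%g | k <- hs1] ++ [seq (z * k)%g | k <- hs2] ++ s.
have sM: {subset M <= G} by do 2?[apply: sub_cat => //]; apply: sub_map.
have szM : (size M).+1 = m.
  by rewrite /M !size_cat !size_map addnA -addSn -addSn szh.
have e1: F ([seq (z * x * k)%g | k <- h :: hs1] ++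
            [seq (z * k)%g | k <- hs2] ++ s)
   = F (x :: M) + F ((z * h)%g :: M).
  by rewrite /= -/M !F_add ?groupM // addrCA addrA.
have e2: F ([seq (z * x * k)%g | k <- hs1] ++
            [seq (z * k)%g | k <- h :: hs2] ++ s)
   = F ((z * h)%g :: M).
  apply: F_sym; first by do 2?[apply: sub_cat => //]; apply: sub_map.
  by rewrite perm_sym; apply: perm_mid.
have e3: F ([seq (z * k)%g | k <- hs1 ++ h :: hs2] ++ s)
   = F ([seq (z * k)%g | k <- (h :: hs1) ++ hs2] ++ s).
  apply: F_sym.
    by apply: sub_cat => //; apply: sub_map => //; exact: sub_cat.
  rewrite perm_cat2r; apply: perm_map.
  by rewrite perm_sym; apply: perm_mid.
have e4: F ([seq (z * k)%g | k <- [seq (x * k)%g | k <- hs1] ++ hs2] ++ x :: s)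
   = F (x :: M).
  apply: F_sym.
    apply: sub_cat; last exact: sub_cons.
    by apply: sub_map => //; apply: sub_cat => //; apply: sub_map.
  rewrite map_cat -map_comp /M catA perm_sym.
  rewrite (eq_map (g := (fun k => (z * k)%g) \o (fun k => (x * k)%g))).
    exact: perm_mid.
  by move=> k /=; rewrite mulgA.
by rewrite e1 e2 e3 e4 -addrA addrC.
Qed.

(** The m-th difference of the diagonal is m! F(xs); it vanishes as soon as the
diagonal is constant on a coset that contains the sampled points. *)
Lemma polarization (H : {group gT}) y k xs :
    H \subset G -> y \in G -> {subset xs <= H} -> size xs = m -> (0 < m)%N ->
    {in (y *: H)%g, forall z, F (nseq m z) = k} ->
  F xs *+ m`! = 0.
Proof.
move=> sHG Gy sxH szx m_gt0 Fk.
have sxG: {subset xs <= G} by move=> x /sxH /(subsetP sHG).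
have := @iter_diff_multiadditive xs (nseq m 1%g) [::] y Gy sxG.
rewrite size_nseq cats0 szx addn0 => <- //; last first.
  by move=> x /nseqP[-> _].
apply: (iter_diff_cst0 (y0 := y) (k := k) sxH);
  rewrite ?szx ?lcoset_refl // => z zH.
by rewrite cats0 map_nseq mulg1 Fk.
Qed.

End Polarization.
(** * Binomial coefficients of a prime power *)

Lemma dvdn_bin_pfactor p e j :
  prime p -> (0 < j)%N -> ~~ (p %| j)%N -> (p ^ e %| 'C(p ^ e, j))%N.
Proof.
move=> p_pr; case: j => // j _ pj.
rewrite -(@Gauss_dvdr _ j.+1) ?coprimeXl ?prime_coprime //.
by rewrite -mul_bin_diag dvdn_mulr.
Qed.

Lemma coprime_fact p m : prime p -> (m < p)%N -> coprime m`! p.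
Proof.
move=> p_pr; elim: m => [|m IH] ltmp; first by rewrite coprime1n.
rewrite factS coprimeMl (IH (ltnW ltmp)) andbT coprime_sym prime_coprime //.
by rewrite gtnNdvd.
Qed.

Lemma bin_pfactor_prime p e : prime p ->
  exists2 r, coprime r p & 'C(p ^ e.+1, p) = (p ^ e * r)%N.
Proof.
move=> p_pr; have p_gt0 := prime_gt0 p_pr; set n := (p ^ e.+1)%N.
exists 'C(n.-1, p.-1); last first.
  apply/eqP; rewrite -(eqn_pmul2l p_gt0) mulnA -expnS -/n.
  by rewrite mul_bin_diag prednK.
suff: coprime ('C(n.-1, p.-1) * (p.-1)`!) p by rewrite coprimeMl => /andP[].
rewrite bin_ffact ffact_prod; elim/big_ind: _ => [|x y|i _].
- by rewrite coprime1n.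
- by rewrite coprimeMl => -> ->.
have ltip : (i.+1 < p)%N by rewrite -ltn_predRL.
have lepn : (p <= n)%N by rewrite /n expnS leq_pmulr // expn_gt0 p_gt0.
have -> : (n.-1 - i = n - i.+1)%N by rewrite -subn1 -subnDA.
have pn : (p %| n)%N by rewrite /n expnS dvdn_mulr.
have lein : (i.+1 <= n)%N := leq_trans (ltnW ltip) lepn.
by rewrite coprime_sym prime_coprime // (dvdn_subr lein pn) gtnNdvd.
Qed.

(** * The derived subgroup as a module *)

Section CommutatorModule.
Variables (gT : finGroupType) (G : {group gT}).
Hypothesis abelA : abelian [~: G, G].
Local Notation A := [~: G, G]%G.
Local Notation V := (fmod_of abelA).
Implicit Types (v w : V) (s t : seq gT).
Local Open Scope ring_scope.

(** The commutator [v, g1, ..., gm], that is v (g1 - 1) ... (gm - 1). *)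
Definition com v s : V := foldl (fun u g => u ^@ g - u) v s.

Let nAG : G \subset 'N(A). Proof. exact: normal_norm (der_normal 1 G). Qed.
Let sAG : A \subset G. Proof. exact: der_sub 1 G. Qed.
Let nA g : g \in G -> g \in 'N(A). Proof. exact: (subsetP nAG). Qed.
Let A_com x y : x \in G -> y \in G -> [~ x, y]%g \in A.
Proof. exact: mem_commg. Qed.

Lemma com_cat v s t : com v (s ++ t) = com (com v s) t.
Proof. exact: foldl_cat. Qed.

Lemma com0 s : com 0 s = 0.
Proof. by elim: s => //= g s IH; rewrite act0r subrr. Qed.

Lemma comD s : {morph com^~ s : v w / v + w}.
Proof.
elim: s => //= g s IH v w; rewrite /= -IH actAr; congr (com _ _).
by rewrite opprD addrACA.
Qed.

Lemma comN s : {morph com^~ s : v / - v}.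
Proof.
by move=> v; apply/eqP; rewrite -addr_eq0 -comD addNr com0.
Qed.

Lemma comMn s k : {morph com^~ s : v / v *+ k}.
Proof.
by move=> v; elim: k => [|k IH]; rewrite ?com0 // !mulrS comD IH.
Qed.

Lemma actr_der v x : x \in A -> v ^@ x = v.
Proof.
move=> Ax; apply: val_inj; rewrite fmvalJ ?nA ?(subsetP sAG) //.
by rewrite conjgE (centsP abelA _ (fmodP v) _ Ax) mulKg.
Qed.

Lemma actrC v g h : g \in G -> h \in G -> v ^@ g ^@ h = v ^@ h ^@ g.
Proof.
move=> Gg Gh; have Ghg : (h * g)%g \in G by rewrite groupM.
rewrite -!actrM ?nA // (commgC g h) [LHS]actrM ?nA ?groupR //.
by rewrite actr_der ?A_com.
Qed.

Lemma com_swap v g h s : g \in G -> h \in G ->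
  com v (g :: h :: s) = com v (h :: g :: s).
Proof.
move=> Gg Gh /=; congr (com _ s).
rewrite !actAr !actNr (actrC _ Gg Gh) -!addrA; congr (_ + _).
by rewrite !opprD !opprK addrCA.
Qed.

Lemma com_perm v s t : {subset s <= G} -> perm_eq s t -> com v s = com v t.
Proof.
have com_mid w g u1 u2 : g \in G -> {subset u1 <= G} ->
    com w (u1 ++ g :: u2) = com w (g :: u1 ++ u2).
  move=> Gg; elim: u1 w => //= h u1 IH w su.
  rewrite -[LHS]/(com _ (u1 ++ g :: u2)) IH; last first.
    by move=> x ux; apply: su; rewrite inE ux orbT.
  by apply: (@com_swap w h g) => //; apply: su; rewrite mem_head.
elim: s t v => [|g s IH] t v sG st.
  by rewrite perm_sym in st; move/perm_nilP: st => ->.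
have tg : g \in t by rewrite -(perm_mem st) mem_head.
have tG : {subset t <= G} by move=> x; rewrite -(perm_mem st) => /sG.
case/splitPr: tg st tG => t1 t2 st tG.
rewrite com_mid ?sG ?mem_head //; last first.
  by move=> x xt; apply: tG; rewrite mem_cat xt.
apply: IH => [x xs|]; first by apply: sG; rewrite inE xs orbT.
rewrite -(perm_cons g); apply: (perm_trans st).
by rewrite perm_sym; apply/permEl/(perm_catCA [:: g]).
Qed.

(** This is gh - 1 = (g - 1) + (h - 1) + (g - 1)(h - 1): up to a commutator of
higher weight, [com] is additive in each of its entries. *)
Lemma com_mul v g h s : g \in G -> h \in G ->
  com v ((g * h)%g :: s)
    = com v (g :: s) + com v (h :: s) + com v (g :: h :: s).
Proof.
move=> Gg Gh; rewrite /com /= -!/(com _ s) -!comD; congr (com _ s).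
by rewrite actrM ?nA // actAr actNr [RHS]addrC addrA !subrK addrA subrK.
Qed.

Lemma com_lcn v s : {subset s <= G} -> (val (com v s) \in 'L_(size s).+2(G))%g.
Proof.
elim/last_ind: s => [|s g IH] sG; first by rewrite lcn2 fmodP.
rewrite -cats1 com_cat size_cat addn1 lcnSn.
have Gg: g \in G by apply: sG; rewrite mem_rcons mem_head.
rewrite [X in val X](_ : _ = fmod abelA [~ val (com v s), g]%g).
  rewrite fmodK ?A_com // ?(subsetP sAG) ?fmodP // mem_commg // IH //.
  by move=> x xs; apply: sG; rewrite mem_rcons inE xs orbT.
apply: val_inj; rewrite fmodK ?A_com // ?(subsetP sAG) ?fmodP //.
by rewrite /= addrC fmvalA fmvalN fmvalJ ?nA.
Qed.

Lemma fmod_commMr x y z : x \in G -> y \in G -> z \in G ->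
  fmod abelA [~ x, y * z]%g
    = fmod abelA [~ x, z]%g + fmod abelA [~ x, y]%g ^@ z.
Proof.
move=> Gx Gy Gz; rewrite commgMJ fmodM ?fmodJ ?nA ?A_com //.
by rewrite memJ_norm ?nA ?A_com.
Qed.

(** In the module, [a, b^k] is the image of [a, b] under 1 + b + ... + b^(k-1);
the right-hand side expands this operator in powers of b - 1. *)
Lemma fmod_commX a b k : a \in G -> b \in G ->
  fmod abelA [~ a, b ^+ k]%g =
    \sum_(i < k) com (fmod abelA [~ a, b]%g) (nseq i b) *+ 'C(k, i.+1).
Proof.
move=> Ga Gb; set c := fmod _ [~ a, b]%g.
have comS i : com c (nseq i.+1 b) = com c (nseq i b) ^@ b - com c (nseq i b).
  by rewrite -[i.+1]addn1 nseqD com_cat.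
elim: k => [|k IH]; first by rewrite expg0 commg1 morph1 big_ord0.
rewrite expgSr fmod_commMr ?groupX // IH -/c actr_sum.
under eq_bigr => i _ do
  rewrite actZr -[_ ^@ b](subrK (com c (nseq i b))) -comS mulrnDl.
rewrite big_split /=.
under [RHS]eq_bigr => i _ do rewrite binS mulrnDr.
rewrite big_split /= [X in _ = X + _]big_ord_recr /= bin_small // mulr0n addr0.
by rewrite [X in _ = _ + X]big_ord_recl bin0 mulr1n [RHS]addrC -addrA.
Qed.

End CommutatorModule.
(** * Relations imposed by the exponent of the central quotient *)

Section PGroup.
Variables (gT : finGroupType) (G : {group gT}) (p e : nat).
Hypotheses (p_pr : prime p) (pG : p.-group G) (abelA : abelian [~: G, G]).
Hypothesis clG : 'L_(2 * p)(G) = 1.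
Local Notation n := (p ^ e.+1)%N.
Local Notation q := (p ^ e)%N.
Hypothesis cenX : forall x, x \in G -> x ^+ n \in 'Z(G).
Local Notation A := [~: G, G]%G.
Local Notation V := (fmod_of abelA).
Local Notation com := (@com gT G abelA).
Local Notation fmodA := (fmod abelA).
Implicit Types (v w : V) (s t : seq gT).
Local Open Scope ring_scope.

Let nAG : G \subset 'N(A). Proof. exact: normal_norm (der_normal 1 G). Qed.
Let sAG : A \subset G. Proof. exact: der_sub 1 G. Qed.
Let p_gt0 : (0 < p)%N := prime_gt0 p_pr.
Let p1_gt0 : (0 < p.-1)%N. Proof. by rewrite -subn1 subn_gt0 prime_gt1. Qed.

Lemma mulrn_coprime_eq0 v r : coprime r p -> v *+ r = 0 -> v = 0.
Proof.
move=> co_rp vr0; apply: val_inj; rewrite fmval0.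
have ord_r : (#[val v] %| r)%N by rewrite order_dvdn -fmvalZ vr0 fmval0.
have pv : p.-elt (val v) by apply: mem_p_elt pG (subsetP sAG _ (fmodP v)).
apply/eqP; rewrite -order_eq1.
have co_p : coprime p #[val v].
  by apply: coprime_dvdr ord_r _; rewrite coprime_sym.
by rewrite (pnat_1 pv) // p'natE // -prime_coprime.
Qed.

Lemma com_long0 v s : {subset s <= G} -> (2 * p - 2 <= size s)%N -> com v s = 0.
Proof.
move=> sG szs; apply: val_inj; rewrite fmval0.
have le2p : (2 * p <= (size s).+2)%N by move: szs; rewrite leq_subLR.
apply/set1gP; rewrite -clG; apply: subsetP (com_lcn v sG).
exact: lcn_sub_leq.
Qed.

(** The n-th power of an element of the derived subgroup is central, so it is
fixed by the action. *)
Lemma com_mulrn_eq0 v s :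
  {subset s <= G} -> (0 < size s)%N -> com v s *+ n = 0.
Proof.
case: s => // g s sG _; have Gg : g \in G by apply: sG; rewrite mem_head.
have vn_fix : (v *+ n) ^@ g = v *+ n.
  apply: val_inj; rewrite fmvalJ ?(subsetP nAG) //.
  have /centerP[_ cent] := cenX (subsetP sAG _ (fmodP v)).
  by rewrite !fmvalZ conjgE (cent _ Gg) mulKg.
by rewrite -comMn /= vn_fix subrr com0.
Qed.

(** The term i = 0 has coefficient n and the term i = p - 1 has coefficient
q r.  In every other term either 2p - 2 <= i, and the commutator is trivial, or
i + 1 < 2p is not a multiple of p, so that n divides the coefficient. *)
Lemma sum_com_binE w b r : b \in G -> 'C(n, p) = (q * r)%N ->
    \sum_(i < n) com w (nseq i b) *+ 'C(n, i.+1) = 0 ->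
  w *+ n + com w (nseq p.-1 b) *+ q *+ r = 0.
Proof.
move=> Gb def_r; rewrite -mulrnA -def_r.
have bG i : {subset nseq i b <= G} by move=> _ /nseqP[-> _].
have n_gt0 : (0 < n)%N by rewrite expn_gt0 p_gt0.
have ltpn : (p.-1 < n)%N by rewrite prednK // expnS leq_pmulr ?expn_gt0 ?p_gt0.
rewrite (bigD1 (Ordinal n_gt0)) //= bin1.
rewrite (bigD1 (Ordinal ltpn)) /=; last by rewrite -val_eqE /= -lt0n.
rewrite prednK // big1 ?addr0 // => i /andP[i_neq0 i_neqp].
rewrite -!val_eqE /= in i_neq0 i_neqp.
have [long_i | short_i] := leqP (2 * p - 2) i.
  by rewrite com_long0 ?size_nseq // mul0rn.
have /dvdnP[k ->] : (n %| 'C(n, i.+1))%N.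
  apply: dvdn_bin_pfactor => //; apply/dvdnP=> -[k def_i].
  have ltk2 : (k < 2)%N.
    rewrite -(ltn_pmul2r p_gt0) -def_i.
    by move: short_i; rewrite ltn_subRL; apply: leq_trans.
  case: k ltk2 def_i => [|[|//]] _; rewrite ?mul0n ?mul1n // => def_i.
  by case/eqP: i_neqp; rewrite /= -[LHS]/(i.+1.-1) def_i.
by rewrite mulnC mulrnA com_mulrn_eq0 ?mul0rn ?bG ?size_nseq ?lt0n.
Qed.

Lemma sum_com_comm0 a b : a \in G -> b \in G ->
  \sum_(i < n) com (fmodA [~ a, b]%g) (nseq i b) *+ 'C(n, i.+1) = 0.
Proof.
move=> Ga Gb; rewrite -fmod_commX //.
have /centerP[_ cent] := cenX Gb.
by rewrite (_ : [~ a, _]%g = 1%g) ?morph1 //; apply/eqP/commgP/commute_sym/cent.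
Qed.

(** Multiplying b by an element y of the derived subgroup does not change the
action of b, but adds [g, y] to [g, b]: the difference of the two relations is
the same relation for [g, y], which is [y, g] up to sign. *)
Lemma sum_com_der0 d g b : g \in G -> b \in G ->
  \sum_(i < n) com (com d [:: g]) (nseq i b) *+ 'C(n, i.+1) = 0.
Proof.
move=> Gg Gb; pose y := val d; have Ay : y \in A := fmodP d.
have Gy : y \in G := subsetP sAG _ Ay.
have com_by w i : com w (nseq i (b * y)%g) = com w (nseq i b).
  elim: i w => //= i IH w; rewrite IH.
  by rewrite actrM ?(subsetP nAG) // actr_der.
have c_by : fmodA [~ g, b * y]%g = fmodA [~ g, b]%g - com d [:: g].
  rewrite fmod_commMr // actr_der // addrC; congr (_ + _).
  rewrite -invg_comm fmodV; congr (- _).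
  apply: val_inj; rewrite fmodK ?mem_commg //.
  by rewrite /= addrC fmvalA fmvalN fmvalJ ?(subsetP nAG).
have := sum_com_comm0 Gg (groupM Gb Gy); rewrite c_by.
under eq_bigr => i _ do rewrite com_by comD comN mulrnDl mulNrn.
rewrite big_split /= sum_com_comm0 // add0r sumrN => /eqP.
by rewrite oppr_eq0 => /eqP.
Qed.

Lemma com_pred_prime_diag0 d g b : g \in G -> b \in G ->
  com (com d [:: g]) (nseq p.-1 b) *+ q = 0.
Proof.
move=> Gg Gb; have [r co_rp def_r] := bin_pfactor_prime e p_pr.
apply: (mulrn_coprime_eq0 co_rp).
have := sum_com_binE Gb def_r (sum_com_der0 d Gg Gb).
by rewrite com_mulrn_eq0 ?add0r // => _ /[!inE] /eqP->.
Qed.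

Let co_fact : coprime (p.-1)`! p.
Proof. by apply: coprime_fact; rewrite ?ltn_predL. Qed.

(** If all products of p operators kill q w, then t |-> q (com w t) is additive
in each entry on lists of length p - 1, since the correction term in [com_mul]
has one more entry. *)
Lemma com_polarization w (H : {group gT}) y k s :
    (forall t, {subset t <= G} -> size t = p -> com w t *+ q = 0) ->
    H \subset G -> y \in G -> {subset s <= H} -> size s = p.-1 ->
    {in (y *: H)%g, forall z, com w (nseq p.-1 z) *+ q = k} ->
  com w s *+ q = 0.
Proof.
move=> w_p0 sHG Gy sH szs const; apply: (mulrn_coprime_eq0 co_fact).
pose F t := com w t *+ q.
apply: (@polarization _ _ G F p.-1 _ _ H y k) => //
  [u t uG ut | g h t Gg Gh tG szt].
  by rewrite /F (com_perm w uG ut).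
rewrite /F com_mul // !mulrnDl [X in _ + X]w_p0 ?addr0 //;
  last by rewrite /= szt prednK.
by do 2![move=> x; rewrite inE => /predU1P[-> // |]; move: x].
Qed.

(** Descending induction on the length of s.  The first entries of s, of which
there is at least one, are absorbed into an element d (g - 1), for which the
diagonal values vanish; the last p - 1 entries are reached from the diagonal by
polarization, which applies by the induction hypothesis for longer lists. *)
Lemma com_prime_eq0 v s :
  {subset s <= G} -> (p <= size s)%N -> com v s *+ q = 0.
Proof.
have [k] := ubnP (2 * p - size s); elim: k => // k IH in v s *.
move=> szk sG szs.
have [long_s | short_s] := leqP (2 * p - 2) (size s).
  by rewrite com_long0 ?mul0rn.
pose i := (size s - p.-1)%N.
have i_gt0 : (0 < i)%N by rewrite subn_gt0 prednK.
have le_p1 : (p.-1 <= size s)%N by rewrite (leq_trans (leq_pred p)).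
rewrite -(cat_take_drop i s) com_cat.
have takeG : {subset take i s <= G} by move=> x /mem_take /sG.
have dropG : {subset drop i s <= G} by move=> x /mem_drop /sG.
apply: (@com_polarization _ G 1%g 0) => // [t tG szt | | z].
- rewrite -com_cat; apply: IH.
  + rewrite size_cat szt size_takel ?leq_subr //.
    have -> : (i + p = (size s).+1)%N by rewrite -{1}(prednK p_gt0) addnS subnK.
    by rewrite subnS prednK // subn_gt0 (leq_trans short_s) // leq_subr.
  + by move=> x; rewrite mem_cat => /orP[/takeG | /tG].
  + by rewrite size_cat szt leq_addl.
- by rewrite size_drop subKn.
rewrite lcoset1 => Gz.
have szt : size (take i s) = i by rewrite size_takel ?leq_subr.
case/lastP: (take i s) szt takeG => [sz0 | t g _ tG].
  by rewrite -sz0 in i_gt0.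
rewrite -cats1 com_cat com_pred_prime_diag0 //.
by apply: tG; rewrite mem_rcons mem_head.
Qed.

(** The relation for (a, z) has the same constant term n [a, b] for all z in
b <[a]>, because [a, b x] differs from [a, b] by [a, b, x], which n kills.  The
function z |-> q (com c (z, ..., z)) is thus constant on that coset, and
polarization makes its value vanish at a, where the relation for (b, a) reads
it as n [a, b] up to a factor prime to p. *)
Lemma comm_mulrn_eq0 a b : a \in G -> b \in G -> fmodA [~ a, b]%g *+ n = 0.
Proof.
move=> Ga Gb; have [r co_rp def_r] := bin_pfactor_prime e p_pr.
set c := fmodA _.
have rel g h : g \in G -> h \in G ->
    com (fmodA [~ g, h]%g) (nseq p.-1 h) *+ q *+ r = - (fmodA [~ g, h]%g *+ n).
  move=> Gg Gh; apply/eqP; rewrite -addr_eq0 addrC; apply/eqP.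
  exact: sum_com_binE (sum_com_comm0 Gg Gh).
have sAa : <[a]> \subset G by rewrite cycle_subG.
have rel_ba : com c (nseq p.-1 a) *+ q *+ r = - (c *+ n).
  have := rel b a Gb Ga; rewrite -invg_comm fmodV -/c comN !mulNrn.
  exact: oppr_inj.
have rel_bx z : z \in (b *: <[a]>)%g ->
    com c (nseq p.-1 z) *+ q *+ r = - (c *+ n).
  case/lcosetP=> x ax ->; have Gx := subsetP sAa _ ax.
  have Gz : (b * x)%g \in G by rewrite groupM.
  have c_z : fmodA [~ a, b * x]%g = c + com c [:: x].
    rewrite fmod_commMr // (_ : [~ a, x]%g = 1%g) ?morph1 ?add0r.
      by rewrite /= addrC subrK.
    by apply/eqP/commgP/(centsP (cycle_abelian a)); rewrite ?cycle_id.
  have cx0 : com c [:: x] *+ n = 0.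
    by rewrite com_mulrn_eq0 // => u; rewrite inE => /eqP->.
  have cxz0 : com c (x :: nseq p.-1 (b * x)%g) *+ q = 0.
    rewrite com_prime_eq0 //= ?size_nseq ?prednK // => u.
    by rewrite inE => /predU1P[-> // | /nseqP[-> _]].
  have c_zn : fmodA [~ a, b * x]%g *+ n = c *+ n.
    by rewrite c_z mulrnDl cx0 addr0.
  by have := rel a _ Ga Gz; rewrite c_zn c_z comD -com_cat mulrnDl cxz0 addr0.
have: com c (nseq p.-1 a) *+ q = 0.
  apply: (@com_polarization _ <[a]>%G b (com c (nseq p.-1 b) *+ q)) => //.
  - by move=> t tG szt; rewrite com_prime_eq0 ?szt.
  - by move=> _ /nseqP[-> _]; exact: cycle_id.
  - by rewrite size_nseq.
  move=> z bz; apply/eqP; rewrite -subr_eq0; apply/eqP.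
  apply: (mulrn_coprime_eq0 co_rp); rewrite mulrnBl !rel_bx ?subrr //.
  exact: lcoset_refl.
move=> c0; move: rel_ba; rewrite c0 mul0rn => /eqP.
by rewrite eq_sym oppr_eq0 => /eqP.
Qed.

End PGroup.

Theorem theorem2p6 (gT : finGroupType) (G : {group gT}) (p : nat)
    (p_prime : prime p) (p_odd : odd p)
    (pG : p.-group G) (metabG : metabelian G)
    (clG : (nil_class G <= 2 * p - 1)%N) :
  (exponent [~: G, G] %| exponent (G / 'Z(G)))%N.
Proof.
have cenX x : x \in G -> x ^+ exponent (G / 'Z(G)) \in 'Z(G).
  move=> Gx; have nZx := subsetP (normal_norm (center_normal G)) _ Gx.
  rewrite coset_idr ?groupX // morphX //.
  by rewrite expg_exponent // mem_quotient.
have: p.-nat (exponent (G / 'Z(G))) by rewrite pnat_exponent quotient_pgroup.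
case/p_natP=> -[|e] def_n; rewrite def_n in cenX *.
  (* n = 1: the group is its own center. *)
  suff -> : [~: G, G] = 1 by rewrite exponent1.
  apply/commG1P; apply: subset_trans (subsetIr G _).
  by apply/subsetP=> x Gx; rewrite -[x]expg1; exact: cenX.
have nilG := pgroup_nil pG.
have cl2p : 'L_(2 * p)(G) = 1.
  have := elimT (lcn_nil_classP _ nilG) clG.
  by rewrite -addn1 subnK // muln_gt0 (prime_gt0 p_prime).
rewrite /= abelian_exponent_gen; last first.
  exact: abelianS (subset_gen _) metabG.
apply/exponentP=> _ /imset2P[a b Ga Gb ->].
have := comm_mulrn_eq0 p_prime pG metabG cl2p cenX Ga Gb.
move/(congr1 (fun v => val v)).
by rewrite fmvalZ fmval0 fmodK // mem_commg.
Qed.
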